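(* Let $N>1$ be an integer. Given any tame $\mathrm{SL}_2$-tiling $\mathbf{M}$ over $\mathbb{Z}/N\mathbb{Z}$ there is a tame $\mathrm{SL}_2$-tiling $\widetilde{\mathbf{M}}$ over $\mathbb{Z}$ with positive integer entries for which $\Theta(\widetilde{\mathbf{M}})=\mathbf{M}$, where $\Theta$ denotes entrywise reduction modulo $N$.
   Context: An $\mathrm{SL}_2$-tiling over a commutative ring $R$ with identity is a function $\mathbf{M}\colon\mathbb{Z}\times\mathbb{Z}\to R$, $m_{i,j}=\mathbf{M}(i,j)$, with $m_{i,j}m_{i+1,j+1}-m_{i,j+1}m_{i+1,j}=1$ for all $i,j\in\mathbb{Z}$. It is tame if every 3-by-3 submatrix of contiguous entries (rows $i-1,i,i+1$, columns $j-1,j,j+1$, for $i,j\in\mathbb{Z}$) has determinant $0$. $\Theta$ is the map from tame $\mathrm{SL}_2$-tilings over $\mathbb{Z}$ to tame $\mathrm{SL}_2$-tilings over $\mathbb{Z}/N\mathbb{Z}$ induced by applying the quotient map $\mathbb{Z}\to\mathbb{Z}/N\mathbb{Z}$ to each entry. *)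

(* Defs.v *)
From mathcomp Require Import all_boot all_order all_algebra.

Set Implicit Arguments.
Unset Strict Implicit.
Unset Printing Implicit Defensive.

Import GRing.Theory.
Local Open Scope ring_scope.

Definition SL2_tiling (R : comPzRingType) (M : int -> int -> R) : Prop :=
  forall i j : int, M i j * M (i + 1) (j + 1) - M i (j + 1) * M (i + 1) j = 1.

Definition block3 (R : comPzRingType) (M : int -> int -> R) (i j : int) :
    'M[R]_3 :=
  \matrix_(a < 3, b < 3) M (i - 1 + (a : nat)%:Z) (j - 1 + (b : nat)%:Z).

Definition tame_SL2_tiling (R : comPzRingType) (M : int -> int -> R) : Prop :=
  SL2_tiling M /\ forall i j : int, \det (block3 M i j) = 0.

(* 'Z_N is Z/NZ only when 1 < N. *)
Definition Theta (N : nat) (M : int -> int -> int) : int -> int -> 'Z_N :=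
  fun i j => (M i j)%:~R.

Lemma Theta_tame (N : nat) (M : int -> int -> int) :
  tame_SL2_tiling M -> tame_SL2_tiling (Theta N M).
Proof.
move=> [sl2M tameM]; split=> i j.
  by rewrite /Theta -!intrM -intrB sl2M.
have -> : block3 (Theta N M) i j = map_mx intr (block3 M i j).
  by apply/matrixP=> a b; rewrite !mxE.
by rewrite det_map_mx tameM.
Qed.

(* Main.v *)
Require Import Defs.
From mathcomp Require Import all_boot all_order all_algebra.
From mathcomp Require Import ring zify.

Set Implicit Arguments.
Unset Strict Implicit.
Unset Printing Implicit Defensive.

Import Order.TTheory GRing.Theory Num.Theory.
Local Open Scope ring_scope.

(** A tame tiling is governed by two sequences.  The vanishing 3-by-3
    determinants force any three consecutive rows to satisfy
    [M (i+1) j + M (i-1) j = la i * M i j] with [la i] independent of [j], and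
    likewise for columns with coefficients [mu j] ([tame_recur2]).  Conversely,
    any [la], [mu] and any 2-by-2 block of determinant 1 at the origin
    propagate to a unique tame tiling ([recur2_exists], [recur2_unique],
    [recur2_tame]).  Lifting a tiling modulo [N] therefore amounts to lifting
    this data, subject to no constraint but the determinant of the block.

    The block lifts to a determinant-1 integer matrix with positive entries
    ([SL2_lift_pos]): this is the surjectivity of SL_2(Z) -> SL_2(Z/NZ), after
    which adding a large multiple of the second row to the first makes
    everything positive.  The coefficients can be lifted to integers as large
    as desired.  A recurrence [f (j+1) = c j * f j - f (j-1)] with all
    [c j >= 2] is convex where it is positive, so it stays positive as soon as
    it does not decrease when leaving the two initial indices in either
    direction ([recur_pos_of_growth]).

    The point of the positivity proof ([recur2_pos]) is to get bounds on [la]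
    and [mu] that are uniform in both indices.  With [la] large, the four
    sequences row 0, row 1, row 2 - row 1 and row (-1) - row 0 are positive at
    columns 0 and 1.  They are four solutions of the [mu]-recurrence, so a [mu]
    large in terms of [la] makes them positive at every column.  Each column
    then does not decrease when leaving rows 0 and 1, hence is positive. *)

(** * Second-order recurrences indexed by the integers *)

Definition recur (R : comPzRingType) (c f : int -> R) : Prop :=
  forall j, f (j + 1) = c j * f j - f (j - 1).

Section Recurrences.
Variable R : comPzRingType.
Implicit Types c f g : int -> R.

Lemma recur_lin c f g (x y : R) :
  recur c f -> recur c g -> recur c (fun j => x * f j + y * g j).
Proof. by move=> cf cg j /=; rewrite cf cg; ring. Qed.

Lemma eq_recur c f g : f =1 g -> recur c f -> recur c g.
Proof. by move=> fg cf j; rewrite -!fg. Qed.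

Lemma recur_unique c f g :
  recur c f -> recur c g -> f 0 = g 0 -> f 1 = g 1 -> f =1 g.
Proof.
move=> cf cg e0 e1 j.
suff [] : f j = g j /\ f (j + 1) = g (j + 1) by [].
elim/int_ind: j => [|n [IH1 IH2]|n [IH1 IH2]]; first by rewrite add0r.
  have -> : n.+1%:Z = n%:Z + 1 by lia.
  by split=> //; rewrite cf cg IH2 addrK IH1.
have -> : - n.+1%:Z = - n%:Z - 1 by lia.
rewrite subrK; split=> //.
have back h : recur c h ->
    h (- n%:Z - 1) = c (- n%:Z) * h (- n%:Z) - h (- n%:Z + 1).
  by move=> ch; rewrite ch; ring.
by rewrite !back // IH1 IH2.
Qed.

(** The pair of values at [n] and [n + 1]. *)
Fixpoint recur_fwd c (x y : R) n : R * R :=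
  if n is n'.+1 then
    let p := recur_fwd c x y n' in (p.2, c n * p.2 - p.1)
  else (x, y).

(** The pair of values at [- n] and [- n + 1]. *)
Fixpoint recur_bwd c (x y : R) n : R * R :=
  if n is n'.+1 then
    let p := recur_bwd c x y n' in (c (- n'%:Z) * p.1 - p.2, p.1)
  else (x, y).

Lemma recur_exists c (x y : R) : exists f, [/\ recur c f, f 0 = x & f 1 = y].
Proof.
exists (fun j => match j with
  | Posz n => (recur_fwd c x y n).1
  | Negz n => (recur_bwd c x y n.+1).1 end); split=> // -[[|n]|n].
- by rewrite /=; ring.
- have -> : n.+1%:Z + 1 = n.+2 by lia.
  by have -> : n.+1%:Z - 1 = n by lia.
- have -> : Negz n - 1 = Negz n.+1 by lia.
  case: n => [|n]; first by rewrite /= !NegzE; ring.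
  have -> : Negz n.+1 + 1 = Negz n by lia.
  by rewrite /= !NegzE; ring.
Qed.

End Recurrences.

(** At a positive value, a coefficient at least 2 makes the next increment at
    least the previous one, so increments that start nonnegative stay so. *)
Lemma recur_growth (c f : int -> int) :
    recur c f -> (forall j, 2 <= c j) -> 0 < f 1 -> f 1 <= f 2 ->
  forall n : nat, 0 < f (n%:Z + 1) /\ f (n%:Z + 1) <= f (n%:Z + 2).
Proof.
move=> cf c2 f1 f2; elim=> [|n [IH1 IH2]]; first by rewrite !add0r.
have -> : n.+1%:Z + 1 = n%:Z + 2 by lia.
have -> : n.+1%:Z + 2 = n%:Z + 2 + 1 by lia.
rewrite cf; have -> : n%:Z + 2 - 1 = n%:Z + 1 by lia.
by have := c2 (n%:Z + 2); nia.
Qed.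

Lemma recur_pos_of_growth (c f : int -> int) :
    recur c f -> (forall j, 2 <= c j) ->
    0 < f 0 -> 0 < f 1 -> f 1 <= f 2 -> f 0 <= f (- 1) ->
  forall j, 0 < f j.
Proof.
move=> cf c2 f0 f1 f12 f0N [n|n].
  case: n => [//|n]; have [+ _] := recur_growth cf c2 f1 f12 n.
  by have -> : n%:Z + 1 = n.+1 by lia.
(* The reflection exchanging 0 and 1 reduces the backward direction to the
   forward one. *)
pose g j := f (1 - j); pose e j := c (1 - j).
have eg : recur e g.
  move=> j; rewrite /g /e.
  have -> : 1 - (j - 1) = 1 - j + 1 by ring.
  have -> : 1 - (j + 1) = 1 - j - 1 by ring.
  by rewrite cf; ring.
have [+ _] := recur_growth eg (fun j => c2 (1 - j)) f0 f0N n.+1.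
by rewrite /g; have -> : 1 - (n.+1%:Z + 1) = Negz n by lia.
Qed.

(** The bound on [c 0] and [c 1] forces the increments just outside [{0, 1}] to
    be nonnegative; requiring it of every [c j] covers [2 <= c j] too. *)
Lemma recur_pos (c f : int -> int) :
    recur c f -> 0 < f 0 -> 0 < f 1 -> (forall j, 1 + f 0 + f 1 <= c j) ->
  forall j, 0 < f j.
Proof.
move=> cf f0 f1 cb.
have e2 : f 2 = c 1 * f 1 - f 0 := cf 1.
have eN : f 1 = c 0 * f 0 - f (- 1) := cf 0.
have c0 := cb 0; have c1 := cb 1.
apply: (recur_pos_of_growth cf) => // [j||]; last by nia.
  by have := cb j; lia.
by rewrite e2; nia.
Qed.

(** * Tame tilings as two-dimensional recurrences *)

Definition recur2 (R : comPzRingType) (la mu : int -> R)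
    (M : int -> int -> R) : Prop :=
  (forall j, recur la (M^~ j)) /\ (forall i, recur mu (M i)).

Section Tame.
Variable R : comPzRingType.
Implicit Types (la mu : int -> R) (M : int -> int -> R).

Lemma int_shift_const (T : Type) (f : int -> T) :
  (forall j, f (j + 1) = f j) -> forall j, f j = f 0.
Proof.
move=> fS; elim/int_ind=> [//|n IH|n IH].
  by rewrite -IH -[RHS]fS; congr f; lia.
by rewrite -IH -[LHS]fS; congr f; lia.
Qed.

Lemma det_mx33 (A : 'M[R]_3) (a : nat -> nat -> R) :
  (forall i j, A i j = a i j) ->
  \det A = a 0 0 * (a 1 1 * a 2 2 - a 1 2 * a 2 1)
         - a 0 1 * (a 1 0 * a 2 2 - a 1 2 * a 2 0)
         + a 0 2 * (a 1 0 * a 2 1 - a 1 1 * a 2 0).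
Proof.
move=> Aa; rewrite (expand_det_row _ ord0) !big_ord_recl big_ord0 /cofactor.
rewrite !(expand_det_row _ ord0) !big_ord_recl !big_ord0 /cofactor !det_mx11.
by rewrite !mxE !Aa /= /bump /= !(expr0, expr1, sqrrN, expr2); ring.
Qed.

Lemma det_block3 M i j :
  \det (block3 M i j) =
    M (i - 1) (j - 1) * (M i j * M (i + 1) (j + 1) - M i (j + 1) * M (i + 1) j)
  - M (i - 1) j * (M i (j - 1) * M (i + 1) (j + 1)
                   - M i (j + 1) * M (i + 1) (j - 1))
  + M (i - 1) (j + 1) * (M i (j - 1) * M (i + 1) j - M i j * M (i + 1) (j - 1)).
Proof.
have s1 (x : int) : x - 1 + 1 = x by ring.
have s2 (x : int) : x - 1 + 2%:Z = x + 1 by ring.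
rewrite (det_mx33 (a := fun a b => M (i - 1 + a%:Z) (j - 1 + b%:Z))).
  by rewrite addr0 addr0 !s1 !s2.
by move=> a b; rewrite mxE.
Qed.

(** Since [M] has unit 2-by-2 minors, Cramer's rule expresses row [i + 1] on
    columns [j], [j + 1] through rows [i] and [i - 1]; the coefficient of row
    [i - 1] is -1, again by the minor condition, and that of row [i] is
    [al i j].  Tameness says that the same combination is correct on column [j - 1], and
    this makes [al i j] independent of [j]. *)
Lemma tame_row_recur M :
  tame_SL2_tiling M -> exists la, forall j, recur la (M^~ j).
Proof.
move=> [sl tame].
pose al i j :=
  M (i - 1) j * M (i + 1) (j + 1) - M (i - 1) (j + 1) * M (i + 1) j.
have slB i j : M (i - 1) j * M i (j + 1) - M (i - 1) (j + 1) * M i j = 1.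
  by have := sl (i - 1) j; rewrite !subrK.
have al0 i j : M (i + 1) j = al i j * M i j - M (i - 1) j.
  by rewrite -[LHS]mulr1 -[X in _ - X]mulr1 -{1}(slB i j) -(sl i j) /al; ring.
have al1 i j : M (i + 1) (j + 1) = al i j * M i (j + 1) - M (i - 1) (j + 1).
  by rewrite -[LHS]mulr1 -[X in _ - X]mulr1 -{1}(slB i j) -(sl i j) /al; ring.
(* As the bottom row of the 3-by-3 block agrees with this combination of the
   other two in its last two columns, the determinant is the discrepancy in
   the first column times a unit minor. *)
have alN i j : M (i + 1) (j - 1) = al i j * M i (j - 1) - M (i - 1) (j - 1).
  have := tame i j; rewrite det_block3 (al0 i j) (al1 i j) => D0.
  rewrite -[LHS]mulr1 -[RHS]mulr1 -(slB i j).
  apply/eqP; rewrite -subr_eq0; apply/eqP; rewrite -[RHS]D0.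
  by ring.
have alS i j : al i (j + 1) = al i j.
  have := alN i (j + 1); have := al0 i (j + 1).
  rewrite addrK => e1 e0.
  by rewrite [RHS]/al e1 e0 -[LHS]mulr1 -(slB i j); ring.
exists (al^~ 0) => j i; rewrite -(int_shift_const (alS i) j); exact: al0.
Qed.

Lemma tame_tr M : tame_SL2_tiling M -> tame_SL2_tiling (fun i j => M j i).
Proof.
move=> [sl tame]; split=> i j; first by rewrite -(sl j i); ring.
rewrite -(tame j i) -[RHS]det_tr; congr (\det _).
by apply/matrixP=> a b; rewrite !mxE.
Qed.

Lemma tame_recur2 M :
  tame_SL2_tiling M -> exists la mu, recur2 la mu M.
Proof.
move=> tM; have [la laM] := tame_row_recur tM.
by have [mu muM] := tame_row_recur (tame_tr tM); exists la, mu; split.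
Qed.

(** Each recurrence carries a contiguous 2-by-2 block to its neighbour by a
    matrix of determinant 1, so all these minors equal the one at the origin;
    the 3-by-3 determinants vanish because the rows are dependent. *)
Lemma recur2_tame la mu M :
  recur2 la mu M -> M 0 0 * M 1 1 - M 0 1 * M 1 0 = 1 -> tame_SL2_tiling M.
Proof.
move=> [laM muM] M0.
pose D i j :=
  M i j * M (i + 1) (j + 1) - M i (j + 1) * M (i + 1) j.
have Di i j : D (i + 1) j = D i j.
  by rewrite /D (laM j (i + 1)) (laM (j + 1) (i + 1)) addrK; ring.
have Dj i j : D i (j + 1) = D i j.
  by rewrite /D (muM i (j + 1)) (muM (i + 1) (j + 1)) addrK; ring.
split=> i j.
  rewrite -[LHS]/(D i j) (int_shift_const (Dj i)).
  by rewrite (int_shift_const (f := D^~ 0)) //= => k; exact: Di.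
by rewrite det_block3 !(laM _ i); ring.
Qed.

(** The solutions form the tensor product of the solution spaces of the two
    recurrences; [s] and [t] are the dual basis to evaluation at 0 and 1. *)
Lemma recur2_exists la mu (a b c d : R) :
  exists M, recur2 la mu M /\ [/\ M 0 0 = a, M 0 1 = b, M 1 0 = c & M 1 1 = d].
Proof.
have [s [ls s0 s1]] := recur_exists la 1 0.
have [t [lt t0 t1]] := recur_exists la 0 1.
have [u [mu_u u0 u1]] := recur_exists mu a b.
have [v [mu_v v0 v1]] := recur_exists mu c d.
exists (fun i j => s i * u j + t i * v j); split; last first.
  by rewrite s0 s1 t0 t1 u0 u1 v0 v1; split; ring.
split=> [j|i]; last exact: recur_lin.
by apply: eq_recur (recur_lin (u j) (v j) ls lt) => i; ring.
Qed.

Lemma recur2_unique la mu M M' :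
    recur2 la mu M -> recur2 la mu M' ->
    M 0 0 = M' 0 0 -> M 0 1 = M' 0 1 -> M 1 0 = M' 1 0 -> M 1 1 = M' 1 1 ->
  forall i j, M i j = M' i j.
Proof.
move=> [laM muM] [laM' muM'] e00 e01 e10 e11 i j.
by apply: (recur_unique (laM j) (laM' j)); apply: recur_unique.
Qed.

End Tame.

(** * Positivity of integer solutions with large coefficients *)

Lemma recur2_pos (la mu : int -> int) (M : int -> int -> int) :
    recur2 la mu M ->
    0 < M 0 0 -> 0 < M 0 1 -> 0 < M 1 0 -> 0 < M 1 1 ->
    let S := M 0 0 + M 0 1 + M 1 0 + M 1 1 in
    (forall i, 1 + S <= la i) ->
    (forall j, 1 + (la 0 + la 1) * S <= mu j) ->
  forall i j, 0 < M i j.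
Proof.
move=> [laM muM] a0 b0 c0 d0 /= laS muS i j.
have e2 k : M 2 k = la 1 * M 1 k - M 0 k := laM k 1.
have eN k : M (- 1) k = la 0 * M 0 k - M 1 k.
  by rewrite (laM k 0 : M 1 k = la 0 * M 0 k - M (- 1) k); ring.
have la0 := laS 0; have la1 := laS 1.
have pos f : recur mu f -> 0 < f 0 -> 0 < f 1 ->
    f 0 + f 1 <= (la 0 + la 1) * (M 0 0 + M 0 1 + M 1 0 + M 1 1) ->
    forall k, 0 < f k.
  move=> muf f0 f1 fS; apply: (recur_pos muf) => // k.
  by apply: le_trans (muS k); rewrite -addrA lerD2l.
have row0 : forall k, 0 < M 0 k by apply: pos => //; nia.
have row1 : forall k, 0 < M 1 k by apply: pos => //; nia.
have up : forall k, 0 < M 2 k - M 1 k.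
  apply: pos.
  - by apply: eq_recur (recur_lin 1 (- 1) (muM 2) (muM 1)) => k; ring.
  - by rewrite e2; nia.
  - by rewrite e2; nia.
  - by rewrite !e2; nia.
have down : forall k, 0 < M (- 1) k - M 0 k.
  apply: pos.
  - by apply: eq_recur (recur_lin 1 (- 1) (muM (- 1)) (muM 0)) => k; ring.
  - by rewrite eN; nia.
  - by rewrite eN; nia.
  - by rewrite !eN; nia.
apply: (recur_pos_of_growth (laM j)) => //.
- by move=> k; have := laS k; lia.
- by rewrite -subr_ge0 ltW.
- by rewrite -subr_ge0 ltW.
Qed.

(** * Lifting from the integers modulo [N] *)

(** Take for [t] the part of [c] made of the primes not dividing [d]: a prime
    factor of [c] divides exactly one of [d] and [t * n], hence not their
    sum. *)
Lemma coprime_shift c d n :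
    (0 < c)%N -> (0 < d)%N ->
    (forall p, prime p -> p %| c -> p %| d -> ~~ (p %| n))%N ->
  exists t, coprime c (d + t * n).
Proof.
move=> c0 d0 cdn; exists (c`_(\pi(d)^'))%N.
set t := (c`_ _)%N.
have [//|gcd_neq1] := boolP (coprime c (d + t * n)).
have [p pp] : exists2 p, prime p & (p %| gcdn c (d + t * n))%N.
  by exists (pdiv (gcdn c (d + t * n))); rewrite ?pdiv_dvd ?pdiv_prime //
     ltn_neqAle eq_sym gcd_neq1 gcdn_gt0 c0.
rewrite dvdn_gcd => /andP[pc pdt].
have [pd|pNd] := boolP (p %| d)%N.
  have := pdt; rewrite dvdn_addr // Euclid_dvdM //.
  rewrite (negbTE (cdn p pp pc pd)) orbF.
  move=> /(pnatP _ (part_gt0 _ _) (part_pnat _ _) p pp).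
  by rewrite !inE /= mem_primes pp d0 pd.
have pt : (p %| t)%N.
  have /partn_dvd := pc; move=> /(_ (\pi(d)^')%N c0); rewrite part_pnat_id //.
  by rewrite pnatE // !inE mem_primes (negbTE pNd) !andbF.
by move: pdt; rewrite dvdn_addl ?dvdn_mulr // (negbTE pNd).
Qed.

Lemma lift_ge N (hN : (1 < N)%N) (z : 'Z_N) (B : nat) :
  exists x : nat, x%:R = z /\ (B <= x)%N.
Proof.
exists (z + N * B)%N; split; last by nia.
by rewrite natrD natrM pchar_Zp // mul0r addr0 natr_Zp.
Qed.

Lemma lift_seq_ge N (hN : (1 < N)%N) (c : int -> 'Z_N) (B : int) :
  exists x : int -> int, forall j, (x j)%:~R = c j /\ B <= x j.
Proof.
exists (fun j => (c j + N * `|B|)%N) => j; split; last by nia.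
by rewrite -pmulrn natrD natrM pchar_Zp // mul0r addr0 natr_Zp.
Qed.

(** The bottom row lifts to a coprime pair [(z, e)] because no prime divides
    [c], [d] and [N] at once.  Complete that row to a determinant-1 matrix by Bezout.
    Modulo [N], two determinant-1 matrices with the same bottom row differ by a
    multiple of that row added to the top one; adding a large positive lift of
    this multiple corrects the top row and makes it positive. *)
Lemma SL2_lift_pos N (hN : (1 < N)%N) (a b c d : 'Z_N) :
    a * d - b * c = 1 ->
  exists x y z w : int,
    [/\ [/\ 0 < x, 0 < y, 0 < z & 0 < w], x * w - y * z = 1 &
        [/\ x%:~R = a, y%:~R = b, z%:~R = c & w%:~R = d]].
Proof.
move=> abcd.
have [z [zc z0]] := lift_ge hN c 1; have [w0 [wd w00]] := lift_ge hN d 1.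
have [x0 [xa _]] := lift_ge hN a 0; have [y0 [yb _]] := lift_ge hN b 0.
have E : (x0 * w0 = y0 * z + 1 %[mod N])%N.
  rewrite -!(val_Zp_nat hN); congr (nat_of_ord _).
  by rewrite natrD !natrM zc wd xa yb -abcd; ring.
have [|t tP] := @coprime_shift z w0 N z0 w00.
  move=> p pp pz pw; apply/negP=> pN.
  have pNdvd m : (p %| m %% N)%N = (p %| m)%N by rewrite /dvdn modn_dvdm.
  have : (p %| (y0 * z + 1) %% N)%N by rewrite -E pNdvd dvdn_mull.
  rewrite pNdvd dvdn_addr ?dvdn_mull // dvdn1 => /eqP p1.
  by rewrite p1 in pp.
pose e := (w0 + t * N)%N.
have [u [v]] := Bezoutz e z.
rewrite /gcdz /= gcdnC (eqP tP) => uv.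
have eN : e%:R = d by rewrite /e natrD natrM pchar_Zp // mulr0 addr0.
have uvN : u%:~R * d + v%:~R * c = 1.
  by rewrite -zc -eN !pmulrn -!intrM -intrD uv.
have [K [Kk KB]] :=
  lift_ge hN (u%:~R * b + v%:~R * a) (`|u| + `|v| + 1).
exists (u + K%:Z * z%:Z), (- v + K%:Z * e%:Z), z%:Z, e%:Z.
have e0 : (0 < e)%N by rewrite addn_gt0 w00.
split; first by split; nia.
  by rewrite -[RHS]uv; ring.
split; rewrite -?pmulrn //.
- rewrite intrD intrM -!pmulrn Kk zc.
  transitivity (u%:~R * (a * d - b * c) + (u%:~R * b + v%:~R * a) * c).
    by rewrite abcd mulr1.
  by rewrite -[RHS]mulr1 -[X in _ = _ * X]uvN; ring.
- rewrite intrD intrM intrN -!pmulrn Kk eN.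
  transitivity (- (v%:~R * (a * d - b * c)) + (u%:~R * b + v%:~R * a) * d).
    by rewrite abcd mulr1.
  by rewrite -[RHS]mulr1 -[X in _ = _ * X]uvN; ring.
Qed.

Theorem theorem12p4 (N : nat) (hN : (1 < N)%N) (M : int -> int -> 'Z_N)
    (hM : tame_SL2_tiling M) :
  exists Mt : int -> int -> int,
    [/\ tame_SL2_tiling Mt,
        forall i j : int, 0 < Mt i j
      & forall i j : int, Theta N Mt i j = M i j].
Proof.
have [la [mu laM]] := tame_recur2 hM.
have [a [b [c [d [[a0 b0 c0 d0] abcd [aM bM cM dM]]]]]] :=
  SL2_lift_pos hN (hM.1 0 0).
pose S := a + b + c + d.
have [La LaP] := lift_seq_ge hN la (1 + S).
have [Mu MuP] := lift_seq_ge hN mu (1 + (La 0 + La 1) * S).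
have [Mt [MtP [e00 e01 e10 e11]]] := recur2_exists La Mu a b c d.
exists Mt; split.
- by apply: recur2_tame MtP _; rewrite e00 e01 e10 e11.
- apply: (recur2_pos MtP); rewrite ?e00 ?e01 ?e10 ?e11 // => k.
    by have [] := LaP k.
  by have [] := MuP k.
- apply: (recur2_unique (la := la) (mu := mu)) => //;
    rewrite /Theta ?e00 ?e01 ?e10 ?e11 //.
  split=> i j /=.
    by rewrite (MtP.1 i j) rmorphB rmorphM /= (LaP j).1.
  by rewrite (MtP.2 i j) rmorphB rmorphM /= (MuP j).1.
Qed.
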